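(* Let $k,n\ge 1$ be integers, let $M=(m_{ij})$ be a $k\times k$ complex Hadamard matrix and let $N_1,\dots,N_k$ be $n\times n$ complex Hadamard matrices. Let $K$ be the $kn\times kn$ block matrix whose $(i,m)$ block is $m_{im}N_m$ ($1\le i,m\le k$). Let $T_m=\log N_m$ ($1\le m\le k$) and $Q=\log M=(q_{im})$. Consider $G=\mathbb{T}^{n+k}=H_1\times H_2$, where $H_1\cong\mathbb{T}^n$ consists of the vectors whose last $k$ coordinates are $0$ and $H_2\cong\mathbb{T}^k$ of those whose first $n$ coordinates are $0$. Let $\tilde T_m\subset H_1$ be the set of columns of $T_m$ extended by $0$ in the last $k$ coordinates, let $\tilde{\mathbf{q}}_m\in H_2$ be the $m$th column of $Q$ extended by $0$ in the first $n$ coordinates, and $\tilde Q=\{\tilde{\mathbf{q}}_1,\dots,\tilde{\mathbf{q}}_k\}$. Let $\mathbf{e}_1,\dots,\mathbf{e}_{n+k}$ be the standard basis row vectors of $\mathbb{Z}^{n+k}$, and put $E_1=\{\mathbf{e}_1,\dots,\mathbf{e}_n\}$, $E_2=\{\mathbf{e}_{n+1},\dots,\mathbf{e}_{n+k}\}$, $$\Gamma=\bigcup_{m=1}^k(\tilde{\mathbf{q}}_m+\tilde T_m)\subset\mathbb{T}^{n+k},\qquad \Sigma=E_1+E_2=\{\mathbf{e}_j+\mathbf{e}_{n+i}:1\le j\le n,\ 1\le i\le k\}\subset\mathbb{Z}^{n+k}.$$ Then $E_1$ is a common spectrum of $\tilde T_1,\dots,\tilde T_k$, $E_2$ is a spectrum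 of $\tilde Q$, $\Sigma$ is a spectrum of $\Gamma$, and, with the elements of $\Sigma$ listed as rows in the order $(i,j)$ lexicographically and those of $\Gamma$ listed as columns in the order $m=1,\dots,k$ (and, for each $m$, in the order of the columns of $T_m$), one has $$\Sigma\Gamma=\log K \pmod 1,$$ that is, $\Sigma\Gamma$ is the block matrix whose $(i,m)$ block is $q_{im}+T_m$ (the scalar $q_{im}$ added to every entry of $T_m$).
   Context: A complex Hadamard matrix of order $r$ is an $r\times r$ complex matrix all of whose entries have absolute value $1$ and whose rows are pairwise orthogonal. For such a matrix $H$, $\log H$ denotes the real matrix, with entries defined mod $1$, such that $H_{j,l}=e^{2\pi i[\log H]_{j,l}}$; a matrix of this form $\log H$ is called log-Hadamard. $\mathbb{T}=\mathbb{R}/\mathbb{Z}$ is identified with $[0,1)$. Elements of $\mathbb{T}^d$ are written as column vectors and characters of $\mathbb{T}^d$ as row vectors in $\mathbb{Z}^d$. A finite set $T\subset\mathbb{T}^d$ with $r$ elements has spectrum $S\subset\mathbb{Z}^d$, $|S|=r$, if the matrix product $ST$ (the elements of $S$ being the rows of the first factor, and those of $T$ the columns of the second) is an $r\times r$ log-Hadamard matrix. *)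

(* Defs.v *)
From mathcomp Require Import all_boot all_order all_algebra.
From mathcomp Require Import ring_quotient.
From mathcomp Require Import all_classical all_reals all_analysis.
From mathcomp Require Import complex.
From mathcomp Require Import ring lra.

Set Implicit Arguments.
Unset Strict Implicit.
Unset Printing Implicit Defensive.

Import Order.TTheory GRing.Theory Num.Theory.

Local Open Scope ring_scope.
Local Open Scope complex_scope.
Local Open Scope classical_set_scope.
Local Open Scope quotient_scope.

Definition int_subgroup (R : realType) : zmodClosed R :=
  GRing.ZmodClosed.clone R (@Num.int_num_subdef R) _.

(* The additive group R / Z; the integers act on it by [*~]. *)
Notation circle R := (Quotient.quot (int_subgroup R)).

Section Circle.
Variable R : realType.
Implicit Types (x y : R) (t : circle R) (z : R[i]).

Lemma circle_pi_eq x y :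
  (\pi_(circle R) x == \pi_(circle R) y) = (x - y \is a Num.int).
Proof. by rewrite -Quotient.idealrBE. Qed.

(* exp (2 i pi x) *)
Definition expi2pi x : R[i] := cos (2 * pi * x) +i* sin (2 * pi * x).

Definition circle_exp t : R[i] := expi2pi (repr t).

(* The t in R / Z such that exp (2 i pi t) = z; meaningful for |z| = 1 only, *)
(* see [circle_logK].                                                        *)
Definition circle_log z : circle R := xget 0 [set t | circle_exp t = z].

Lemma expi2piD x y : expi2pi (x + y) = expi2pi x * expi2pi y.
Proof. by rewrite /expi2pi mulrDr cosD sinD; simpc; congr (_ +i* _); ring. Qed.

Lemma expi2pi_eq1 x : (expi2pi x == 1) = (x \is a Num.int).
Proof.
have sin0 (n : nat) : sin (pi * n%:R) = 0 :> R.
  elim: n => [|n IHn]; first by rewrite mulr0 sin0.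
  by rewrite -natr1 mulrDr mulr1 sinDpi IHn oppr0.
have sin0z (m : int) : sin (pi * m%:~R) = 0 :> R.
  case: m => n; first exact: sin0.
  by rewrite NegzE mulrNz mulrN sinN [_%:~R]/= sin0 oppr0.
have cos2 y : cos (2 * pi * y) = 1 - 2 * sin (pi * y) ^+ 2.
  have -> : 2 * pi * y = (pi * y) *+ 2 by ring.
  by rewrite cos_mulr2n cos2sin2; ring.
have sin2 y : sin (2 * pi * y) = 2 * cos (pi * y) * sin (pi * y).
  have -> : 2 * pi * y = (pi * y) *+ 2 by ring.
  by rewrite sin_mulr2n; ring.
have expz (m : int) : expi2pi m%:~R = 1.
  by rewrite /expi2pi cos2 sin2 sin0z expr0n !mulr0 subr0.
apply/idP/idP => [/eqP x1|/intrP[m ->]]; last by rewrite expz.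
have xE : x = (x - (Num.floor x)%:~R) + (Num.floor x)%:~R by ring.
move: x1; rewrite xE expi2piD expz mulr1; set f := x - _.
have f0 : 0 <= f by rewrite subr_ge0 floor_le.
have f1 : f < 1 by have := Num.Theory.floorD1_gt x; rewrite intrD /f; lra.
move=> [c1 _]; move: f0; rewrite le_eqVlt => /predU1P[<-|f0].
  by rewrite add0r intr_int.
have spos : 0 < sin (pi * f).
  by apply: sin_gt0_pi; rewrite mulr_gt0 ?pi_gt0//= gtr_pMr ?pi_gt0.
by move: c1; rewrite cos2 => c1; nra.
Qed.

Lemma expi2pi_eq x y : (expi2pi x == expi2pi y) = (x - y \is a Num.int).
Proof.
have yN : expi2pi y * expi2pi (- y) = 1.
  by apply/eqP; rewrite -expi2piD subrr expi2pi_eq1 int_num0.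
rewrite -expi2pi_eq1 expi2piD; apply/eqP/eqP => [->//|xy].
by rewrite -[LHS]mulr1 -yN [expi2pi y * _]mulrC mulrA xy mul1r.
Qed.

Lemma circle_exp_pi x : circle_exp (\pi_(circle R) x) = expi2pi x.
Proof. by apply/eqP; rewrite /circle_exp expi2pi_eq -circle_pi_eq reprK. Qed.

Lemma circle_exp_inj : injective circle_exp.
Proof.
move=> t u /eqP; rewrite /circle_exp expi2pi_eq -circle_pi_eq !reprK.
exact/eqP.
Qed.

Lemma circle_logK z : `|z| = 1 -> circle_exp (circle_log z) = z.
Proof.
move=> z1.
suff [x xz] : exists x, expi2pi x = z.
  apply: (@xgetPex _ 0 [set t | circle_exp t = z]).
  by exists (\pi_(circle R) x); rewrite /= circle_exp_pi.
case: z z1 => a b; rewrite normc_def => -[/(congr1 (fun u => u ^+ 2))].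
rewrite sqr_sqrtr ?addr_ge0 ?sqr_ge0// expr1n => ab1.
have a1 : -1 <= a <= 1 by apply/andP; split; nra.
have pi0 : pi != 0 :> R by rewrite gt_eqF// pi_gt0.
have sinE : sin (acos a) = `|b|.
  by rewrite sin_acos// (_ : 1 - a ^+ 2 = b ^+ 2) ?sqrtr_sqr//; lra.
have [b0|b0] := leP 0 b.
  exists (acos a / (2 * pi)); rewrite /expi2pi mulrC divfK ?mulf_neq0//.
  by rewrite acosK ?in_itv// sinE ger0_norm.
exists (- (acos a / (2 * pi))); rewrite /expi2pi mulrN mulrC divfK ?mulf_neq0//.
by rewrite cosN sinN acosK ?in_itv// sinE ltr0_norm// opprK.
Qed.

End Circle.

Section Hadamard.
Variable R : realType.

Definition complex_hadamard r (H : 'M[R[i]]_r) : Prop :=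
  (forall j l, `|H j l| = 1) /\
  (forall j j', j != j' -> \sum_l H j l * (H j' l)^* = 0).

Definition logmx p q (H : 'M[R[i]]_(p, q)) : 'M[circle R]_(p, q) :=
  map_mx (@circle_log R) H.

Definition log_hadamard r (L : 'M[circle R]_r) : Prop :=
  exists2 H : 'M[R[i]]_r, complex_hadamard H & L = logmx H.

(* The matrix product S T, for S over Z and T over R / Z. *)
Definition zmulmx p d q (S : 'M[int]_(p, d)) (T : 'M[circle R]_(d, q)) :
    'M[circle R]_(p, q) :=
  \matrix_(a, b) \sum_c T c b *~ S a c.

(* The rows of s (resp. the columns of t) list the elements of S (resp. T)   *)
(* without repetition; S T is log-Hadamard for one such listing iff it is    *)
(* for all of them, as permuting the rows and columns of a complex Hadamard  *)
(* matrix yields a complex Hadamard matrix.                                  *)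
Definition row_listing r d (s : 'M[int]_(r, d)) (S : set 'rV[int]_d) : Prop :=
  set_bij [set: 'I_r] S (fun a => row a s).

Definition col_listing r d (t : 'M[circle R]_(d, r))
    (T : set 'cV[circle R]_d) : Prop :=
  set_bij [set: 'I_r] T (fun b => col b t).

Definition spectrum d (S : set 'rV[int]_d) (T : set 'cV[circle R]_d) : Prop :=
  exists r (s : 'M[int]_(r, d)) (t : 'M[circle R]_(d, r)),
    [/\ row_listing s S, col_listing t T & log_hadamard (zmulmx s t)].

End Hadamard.

Section Construction.
Variables (R : realType) (k n : nat).

Definition E1 : set 'rV[int]_(n + k) :=
  [set delta_mx 0 (lshift k j) | j in [set: 'I_n]].

Definition E2 : set 'rV[int]_(n + k) :=
  [set delta_mx 0 (rshift n i) | i in [set: 'I_k]].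

Definition Sigma : set 'rV[int]_(n + k) :=
  [set e + f | e in E1 & f in E2].

(* Rows in lexicographic order of (i, j). *)
Definition Sigma_mx : 'M[int]_(\sum_(i < k) n, n + k) :=
  \mxcol_(i < k) \matrix_(j < n)
    (delta_mx 0 (lshift k j) + delta_mx 0 (rshift n i)).

Variables (T : 'I_k -> 'M[circle R]_n) (Q : 'M[circle R]_k).

Definition tcol (m : 'I_k) (l : 'I_n) : 'cV[circle R]_(n + k) :=
  col_mx (col l (T m)) 0.

Definition tset (m : 'I_k) : set 'cV[circle R]_(n + k) :=
  range (tcol m).

Definition qcol (m : 'I_k) : 'cV[circle R]_(n + k) :=
  col_mx 0 (col m Q).

Definition qset : set 'cV[circle R]_(n + k) := range qcol.

Definition Gamma : set 'cV[circle R]_(n + k) :=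
  \bigcup_(m in [set: 'I_k]) [set qcol m + t | t in tset m].

(* Columns in lexicographic order of (m, l). *)
Definition Gamma_mx : 'M[circle R]_(n + k, \sum_(m < k) n) :=
  \mxrow_(m < k) \matrix_(a < n + k, l < n) (qcol m + tcol m l) a 0.

End Construction.

Arguments E1 k n : clear implicits.
Arguments E2 k n : clear implicits.
Arguments Sigma k n : clear implicits.
Arguments Sigma_mx k n : clear implicits.
Arguments tset {R k n} T m.
Arguments qset {R k} n Q.
Arguments Gamma {R k n} T Q.
Arguments Gamma_mx {R k n} T Q.

(* Main.v *)
Require Import Defs.
From mathcomp Require Import all_boot all_order all_algebra.
From mathcomp Require Import all_classical all_reals all_analysis.
From mathcomp Require Import complex.
From mathcomp Require Import ring_quotient.

(** Exponentiating, the (i, m) block q_im + T_m of Sigma Gamma becomes the block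
    m_im N_m of K, which is Hadamard: the inner product of the rows (i, j) and
    (i', j') is \sum_m m_im conj(m_i'm) <(N_m)_j, (N_m)_j'>, which vanishes by
    the orthogonality of each N_m if j <> j' and by that of M if j = j'.  The rows
    and the columns of a Hadamard matrix are distinct, so whenever S T is
    log-Hadamard the given listings of S and T have no repetition. *)

Set Implicit Arguments.
Unset Strict Implicit.
Unset Printing Implicit Defensive.

Import Order.TTheory GRing.Theory Num.Theory.

Local Open Scope ring_scope.
Local Open Scope complex_scope.
Local Open Scope classical_set_scope.

(** * Exponential and logarithm on R / Z *)

Section Circle.
Local Open Scope quotient_scope.
Variable R : realType.
Implicit Types (t u : circle R) (z w : R[i]).

Lemma circle_expD t u : circle_exp (t + u) = circle_exp t * circle_exp u.
Proof.
(* The projection is additive, so the sum of the representatives represents [t + u], and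
   [circle_exp] may be computed on any representative. *)
rewrite -[t]reprK -[u]reprK.
rewrite -(raddfD (\pi_(circle R) : {additive R -> circle R})) !circle_exp_pi.
exact: expi2piD.
Qed.

(** [circle_exp] is injective and turns sums into products; modulus 1 is what makes [circle_log] a
    genuine inverse. *)
Lemma circle_logM z w : `|z| = 1 -> `|w| = 1 ->
  circle_log (z * w) = circle_log z + circle_log w.
Proof.
move=> z1 w1; apply: circle_exp_inj.
by rewrite circle_expD !circle_logK ?normrM ?z1 ?w1 ?mulr1.
Qed.

Lemma circle_log_inj z w : `|z| = 1 -> `|w| = 1 ->
  circle_log z = circle_log w -> z = w.
Proof. by move=> z1 w1 zw; rewrite -(circle_logK z1) zw circle_logK. Qed.

End Circle.

(** * Flattened block indices and listings *)

Lemma sum_Rank (V : nmodType) p (p_ : 'I_p -> nat)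
    (F : 'I_(\sum_(i < p) p_ i) -> V) :
  \sum_s F s = \sum_i \sum_(j < p_ i) F (tagnat.Rank i j).
Proof.
rewrite sig_big_dep/= (reindex _ (@tagnat.sig_bij_on _ p_))/=.
by apply: eq_bigr => s _; rewrite tagnat.sig2K.
Qed.

Lemma mxblock_Rank (T : Type) p q (p_ : 'I_p -> nat) (q_ : 'I_q -> nat)
    (B : forall i j, 'M[T]_(p_ i, q_ j)) i j (a : 'I_(p_ i)) (b : 'I_(q_ j)) :
  (\mxblock_(i < p, j < q) B i j) (tagnat.Rank i a) (tagnat.Rank j b) = B i j a b.
Proof. by rewrite -[in RHS](mxblockK B) [RHS]mxE. Qed.

Lemma set_bij_range (aT rT : Type) (f : aT -> rT) :
  injective f -> set_bij [set: aT] (range f) f.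
Proof. by move=> fI; split=> [x _|x y _ _ /fI//|//]; exists x. Qed.

(** * Hadamard matrices, log-Hadamard matrices and spectra *)

Section Hadamard.
Variable R : realType.

Lemma mul_conjc_eq1 (z : R[i]) : `|z| = 1 -> z * z^* = 1.
Proof. by move=> z1; rewrite -sqr_normc z1 expr1n. Qed.

(** Unimodular entries already force the diagonal of [H] times its adjoint to be [r]; only
    orthogonality remains to be encoded. *)
Lemma complex_hadamardP r (H : 'M[R[i]]_r) :
  (forall j l, `|H j l| = 1) ->
  complex_hadamard H <-> H *m (map_mx conjc H)^T = r%:R%:M.
Proof.
move=> H1; split=> [[_ H0]|HH].
  apply/matrixP => j j'; rewrite !mxE.
  under eq_bigr do rewrite !mxE.
  have [<-|jj'] := eqVneq j j'; last by rewrite H0.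
  rewrite (eq_bigr (fun=> 1)) => [|l _]; last exact: mul_conjc_eq1.
  by rewrite sumr_const card_ord.
split=> // j j' jj'; move/matrixP/(_ j j'): HH; rewrite !mxE (negPf jj') mulr0n.
by apply: etrans; apply: eq_bigr => l _; rewrite !mxE.
Qed.

(** A one-sided inverse of a square matrix is two-sided: the adjoint divided by [r] also inverts [H]
    from the left, and transposing that identity gives the claim. *)
Lemma complex_hadamard_tr r (H : 'M[R[i]]_r) :
  complex_hadamard H -> complex_hadamard H^T.
Proof.
move=> hH; have H1 := hH.1; apply/complex_hadamardP => [j l|].
  by rewrite mxE.
(* The empty matrix is set aside so that [r] can be inverted. *)
case: r H hH H1 => [|r] H hH H1; first by apply/matrixP => -[].
have r0 : (r.+1%:R : R[i]) \is a GRing.unit by rewrite unitfE pnatr_eq0.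
move/complex_hadamardP: hH => /(_ H1) HH.
have : (r.+1%:R^-1 *: H) *m (map_mx conjc H)^T = 1%:M.
  by rewrite -scalemxAl HH scale_scalar_mx mulVr.
move=> /mulmx1C; rewrite -scalemxAr => /(congr1 ( *:%R r.+1%:R)).
rewrite scalerA mulrV// scale1r scalemx1 => /(congr1 trmx).
by rewrite trmx_mul tr_scalar_mx trmxK map_trmx trmxK.
Qed.

(** Distinct indices with equal rows would have inner product [r], which is nonzero because an index
    [j] below [r] exists. *)
Lemma complex_hadamard_row_inj r (H : 'M[R[i]]_r) :
  complex_hadamard H -> injective (fun j => row j H).
Proof.
move=> [H1 H0] j j' /rowP jj'; apply/eqP/negPn/negP => /H0/eqP.
rewrite (eq_bigr (fun=> 1)) => [|l _].
  by rewrite sumr_const card_ord pnatr_eq0 eqn0Ngt (leq_trans _ (ltn_ord j)).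
by have := jj' l; rewrite !mxE => ->; exact: mul_conjc_eq1.
Qed.

Lemma complex_hadamard_mxblock k n (M : 'M[R[i]]_k) (N : 'I_k -> 'M[R[i]]_n) :
  complex_hadamard M -> (forall m, complex_hadamard (N m)) ->
  complex_hadamard (\mxblock_(i < k, m < k) (M i m *: N m)).
Proof.
move=> [M1 M0] hN; split=> [s t|s s'].
  rewrite -[s]tagnat.sig2K -[t]tagnat.sig2K mxblock_Rank mxE normrM M1 mul1r.
  exact: (hN _).1.
rewrite -[s]tagnat.sig2K -[s']tagnat.sig2K sum_Rank.
(* From here rows are pairs (block, position), and the hypothesis says that the pairs differ. *)
move: (tagnat.sig1 s) (tagnat.sig1 s') (tagnat.sig2 s) (tagnat.sig2 s').
move=> /= i i' j j' ss'.
have E m : \sum_l (M i m *: N m) j l * ((M i' m *: N m) j' l)^* =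
    M i m * (M i' m)^* * \sum_l N m j l * (N m j' l)^*.
  by rewrite mulr_sumr; apply: eq_bigr => l _; rewrite !mxE rmorphM mulrACA.
under eq_bigr => m _ do under eq_bigr do rewrite !mxblock_Rank.
under eq_bigr do rewrite E.
have [jj'|jj'] := eqVneq j j'; last first.
  by apply: big1 => m _; rewrite (hN m).2// mulr0.
have ii' : i != i'.
  by apply: contraNneq ss' => ii'; rewrite ii' jj'.
(* For equal positions every inner sum is the squared norm [n] of a row of [N m]; being independent
   of [m], it factors out. *)
transitivity ((\sum_m M i m * (M i' m)^*) * n%:R); last by rewrite M0 ?mul0r.
rewrite mulr_suml; apply: eq_bigr => m _.
congr (_ * _); rewrite jj' (eq_bigr (fun=> 1)) => [|l _].
  by rewrite sumr_const card_ord.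
by rewrite mul_conjc_eq1 ?(hN m).1.
Qed.

Lemma tr_log_hadamard r (L : 'M[circle R]_r) :
  log_hadamard L -> log_hadamard L^T.
Proof.
move=> [H hH ->]; exists H^T; first exact: complex_hadamard_tr.
by rewrite /logmx map_trmx.
Qed.

(** [circle_log] is injective on unimodular numbers, so equal rows of the logarithm come from equal
    rows of the Hadamard matrix. *)
Lemma log_hadamard_row_inj r (L : 'M[circle R]_r) :
  log_hadamard L -> injective (fun j => row j L).
Proof.
move=> [H hH ->] j j' /rowP jj'; apply: (complex_hadamard_row_inj hH).
apply/rowP => l; have := jj' l; rewrite !mxE.
exact: circle_log_inj (hH.1 _ _) (hH.1 _ _).
Qed.

Lemma row_zmulmx p d q (S : 'M[int]_(p, d)) (T : 'M[circle R]_(d, q)) a :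
  row a (zmulmx S T) = zmulmx (row a S) T.
Proof. by apply/rowP => b; rewrite !mxE; apply: eq_bigr => c _; rewrite mxE. Qed.

Lemma col_zmulmx p d q (S : 'M[int]_(p, d)) (T : 'M[circle R]_(d, q)) b :
  col b (zmulmx S T) = zmulmx S (col b T).
Proof. by apply/colP => a; rewrite !mxE; apply: eq_bigr => c _; rewrite mxE. Qed.

(** A repetition among the rows of [s] would be a repetition among the rows of the product. *)
Lemma log_hadamard_row_listing r d (s : 'M[int]_(r, d))
    (t : 'M[circle R]_(d, r)) :
  log_hadamard (zmulmx s t) -> row_listing s (range (fun a => row a s)).
Proof.
move=> st; apply: set_bij_range => a a' aa'; apply: (log_hadamard_row_inj st).
by rewrite !row_zmulmx aa'.
Qed.

Lemma log_hadamard_col_listing r d (s : 'M[int]_(r, d))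
    (t : 'M[circle R]_(d, r)) :
  log_hadamard (zmulmx s t) -> col_listing t (range (fun b => col b t)).
Proof.
move=> /tr_log_hadamard st; apply: set_bij_range => b b' bb'.
by apply: (log_hadamard_row_inj st); rewrite -!tr_col !col_zmulmx bb'.
Qed.

Lemma log_hadamard_spectrum r d (s : 'M[int]_(r, d))
    (t : 'M[circle R]_(d, r)) :
  log_hadamard (zmulmx s t) ->
  spectrum (range (fun a => row a s)) (range (fun b => col b t)).
Proof.
move=> st; exists r, s, t; split=> //; first exact: log_hadamard_row_listing st.
exact: log_hadamard_col_listing st.
Qed.

(** A basis character reads off one coordinate, which reduces all the products below to reading
    entries. *)
Lemma zmulmx_delta d q (T : 'M[circle R]_(d, q)) (c : 'I_d) :
  zmulmx (delta_mx 0 c) T = row c T.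
Proof.
apply/rowP => b; rewrite !mxE (bigD1 c)//= !mxE !eqxx mulr1z big1 ?addr0// => c'.
by move=> /negPf c'c; rewrite mxE c'c mulr0z.
Qed.

Lemma zmulmxDl p d q (S S' : 'M[int]_(p, d)) (T : 'M[circle R]_(d, q)) :
  zmulmx (S + S') T = zmulmx S T + zmulmx S' T.
Proof.
apply/matrixP => a b; rewrite !mxE -big_split.
by apply: eq_bigr => c _; rewrite mxE mulrzDr.
Qed.

End Hadamard.

(** * The products and spectra for E1, E2, Sigma and Gamma *)

Section Construction.
Variables (R : realType) (k n : nat).

Lemma row_Sigma_mx i (j : 'I_n) :
  row (tagnat.Rank i j) (Sigma_mx k n) =
  delta_mx 0 (lshift k j) + delta_mx 0 (rshift n i).
Proof.
have := mxcolK (fun i : 'I_k => \matrix_(j < n)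
  (delta_mx 0 (lshift k j) + delta_mx 0 (rshift n i) : 'rV[int]_(n + k))) i.
by move=> /row_matrixP/(_ j); rewrite rowK => <-; apply/rowP => c; rewrite !mxE.
Qed.

Lemma range_row_Sigma_mx : range (fun s => row s (Sigma_mx k n)) = Sigma k n.
Proof.
apply/seteqP; split=> [_ [s _ <-]|_ [_ [j _ <-] [_ [i _ <-] <-]]].
  rewrite -[s]tagnat.sig2K row_Sigma_mx.
  by exists (delta_mx 0 (lshift k (tagnat.sig2 s))); [exists (tagnat.sig2 s)|
     exists (delta_mx 0 (rshift n (tagnat.sig1 s))); [exists (tagnat.sig1 s)|]].
by exists (tagnat.Rank i j) => //; rewrite row_Sigma_mx.
Qed.

Variables (T : 'I_k -> 'M[circle R]_n) (Q : 'M[circle R]_k).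

Lemma col_Gamma_mx m (l : 'I_n) :
  col (tagnat.Rank m l) (Gamma_mx T Q) = qcol n Q m + tcol T m l.
Proof.
have := mxrowK (fun m : 'I_k => \matrix_(a < n + k, l < n)
  (qcol n Q m + tcol T m l) a 0) m.
move=> /matrixP E; apply/colP => a; have := E a l.
by rewrite [RHS]mxE => <-; rewrite !mxE.
Qed.

Lemma range_col_Gamma_mx : range (fun s => col s (Gamma_mx T Q)) = Gamma T Q.
Proof.
apply/seteqP; split=> [_ [s _ <-]|_ [m _ [_ [l _ <-] <-]]].
  rewrite -[s]tagnat.sig2K col_Gamma_mx; exists (tagnat.sig1 s) => //.
  by exists (tcol T (tagnat.sig1 s) (tagnat.sig2 s)) => //; exists (tagnat.sig2 s).
by exists (tagnat.Rank m l) => //; rewrite col_Gamma_mx.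
Qed.

Lemma zmulmx_Sigma_Gamma :
  zmulmx (Sigma_mx k n) (Gamma_mx T Q) =
  \mxblock_(i < k, m < k) (const_mx (Q i m) + T m).
Proof.
apply/matrixP => s t; rewrite -[s]tagnat.sig2K -[t]tagnat.sig2K mxblock_Rank.
move: (tagnat.sig1 s) (tagnat.sig1 t) (tagnat.sig2 s) (tagnat.sig2 t).
move=> /= i m j l.
have GE a : Gamma_mx T Q a (tagnat.Rank m l) = qcol n Q m a 0 + tcol T m l a 0.
  by have /colP/(_ a) := col_Gamma_mx m l; rewrite [LHS]mxE => ->; rewrite mxE.
transitivity (row (tagnat.Rank i j) (zmulmx (Sigma_mx k n) (Gamma_mx T Q))
  0 (tagnat.Rank m l)).
  by rewrite [RHS]mxE.
rewrite row_zmulmx row_Sigma_mx zmulmxDl !zmulmx_delta.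
rewrite [LHS]mxE [X in X + _]mxE [X in _ + X]mxE !GE.
(* At coordinate [j] only [tcol] contributes, at coordinate [n + i] only [qcol]; the supports in H1
   and H2 are disjoint. *)
by rewrite /qcol /tcol !col_mxEu !col_mxEd !mxE add0r addr0 addrC.
Qed.

(** The left factor does not depend on [m], which is why the spectrum is common to all the
    [tset T m]. *)
Lemma zmulmx_E1 m :
  zmulmx (\matrix_j delta_mx 0 (lshift k j)) (\matrix_(a, l) tcol T m l a 0) =
  T m.
Proof.
apply/row_matrixP => j; rewrite row_zmulmx rowK zmulmx_delta.
by apply/rowP => l; rewrite 2!mxE col_mxEu !mxE.
Qed.

Lemma zmulmx_E2 :
  zmulmx (\matrix_i delta_mx 0 (rshift n i)) (\matrix_(a, m) qcol n Q m a 0) = Q.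
Proof.
apply/row_matrixP => j; rewrite row_zmulmx rowK zmulmx_delta.
by apply/rowP => l; rewrite 2!mxE col_mxEd !mxE.
Qed.

Lemma spectrum_E1 m : log_hadamard (T m) -> spectrum (E1 k n) (tset T m).
Proof.
rewrite -{1}zmulmx_E1 => /log_hadamard_spectrum; congr spectrum; congr image.
  by apply/funext => j; rewrite rowK.
by apply/funext => l; apply/colP => a; rewrite !mxE.
Qed.

Lemma spectrum_E2 : log_hadamard Q -> spectrum (E2 k n) (qset n Q).
Proof.
rewrite -{1}zmulmx_E2 => /log_hadamard_spectrum; congr spectrum; congr image.
  by apply/funext => i; rewrite rowK.
by apply/funext => m; apply/colP => a; rewrite !mxE.
Qed.

End Construction.

Lemma logmx_mxblock (R : realType) k n (M : 'M[R[i]]_k) (N : 'I_k -> 'M[R[i]]_n) :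
  (forall i m, `|M i m| = 1) -> (forall m j l, `|N m j l| = 1) ->
  logmx (\mxblock_(i < k, m < k) (M i m *: N m)) =
  \mxblock_(i < k, m < k) (const_mx (logmx M i m) + logmx (N m)).
Proof.
move=> M1 N1; apply/matrixP => s t; rewrite mxE.
rewrite -[s]tagnat.sig2K -[t]tagnat.sig2K !mxblock_Rank.
by rewrite !mxE circle_logM ?M1 ?N1.
Qed.

Theorem mainTheorem7 (R : realType) (k n : nat) (hk : (0 < k)%N) (hn : (0 < n)%N)
    (M : 'M[R[i]]_k) (N : 'I_k -> 'M[R[i]]_n)
    (hM : complex_hadamard M) (hN : forall m, complex_hadamard (N m)) :
  let K := \mxblock_(i < k, m < k) (M i m *: N m) in
  let T := fun m => logmx (N m) in
  let Q := logmx M in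
  [/\ forall m, spectrum (E1 k n) (tset T m),
      spectrum (E2 k n) (qset n Q),
      spectrum (Sigma k n) (Gamma T Q) &
      [/\ row_listing (Sigma_mx k n) (Sigma k n),
          col_listing (Gamma_mx T Q) (Gamma T Q),
          zmulmx (Sigma_mx k n) (Gamma_mx T Q) = logmx K &
          zmulmx (Sigma_mx k n) (Gamma_mx T Q) =
            \mxblock_(i < k, m < k) (const_mx (Q i m) + T m)]].
Proof.
move=> K T Q.
have KE := logmx_mxblock hM.1 (fun m => (hN m).1).
have SG := zmulmx_Sigma_Gamma T Q.
(* Both the spectral claim and the absence of repetitions in the two listings follow from this
   single fact, witnessed by [K]. *)
have SGh : log_hadamard (zmulmx (Sigma_mx k n) (Gamma_mx T Q)).
  by exists K; [exact: complex_hadamard_mxblock hM hN|exact: etrans SG (esym KE)].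
rewrite -range_row_Sigma_mx -range_col_Gamma_mx; split.
- by move=> m; apply: spectrum_E1; exists (N m).
- by apply: spectrum_E2; exists M.
- exact: log_hadamard_spectrum.
- split; [exact: (log_hadamard_row_listing SGh)|
           exact: (log_hadamard_col_listing SGh)| |exact: SG].
  exact: etrans SG (esym KE).
Qed.
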